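(* Let $r \in \mathbb{N} = \{0, 1, 2, \ldots\}$ and let $X = \mathbb{P}\left(\mathcal{O}_{\mathbb{P}^1} \oplus \mathcal{O}_{\mathbb{P}^1}(r)\right)$, with irreducible torus-invariant divisors $D_0, D_1, D_2, D_3$ (specified in the context). Then: 1. Each of $-K_X$ and $-(K_X + D_0)$ is ample if and only if $r \in \{0, 1\}$. 2. If $D \in \{D_1, \, D_3, \, D_0 + D_1, \, D_0 + D_3\}$, then $-(K_X + D)$ is ample if and only if $r = 0$. 3. If $D \in \{D_2, \, D_2 + D_1, \, D_2 + D_3\}$, then $-(K_X + D)$ is ample if and only if $r \in \mathbb{N}$ (i.e. it is ample for every $r \in \mathbb{N}$). 4. If $D \in \{D_0 + D_2, \, D_1 + D_3\}$, then $-(K_X + D)$ is not ample for any $r \in \mathbb{N}$.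
   Context: Everything is over $\mathbb{C}$. $K_X$ denotes the canonical divisor. Let $(e_1, e_2)$ be the standard basis of $\mathbb{Z}^2$. The surface $X = \mathbb{P}\left(\mathcal{O}_{\mathbb{P}^1} \oplus \mathcal{O}_{\mathbb{P}^1}(r)\right)$, with projection $\pi : X \to \mathbb{P}^1$, is the smooth complete toric surface whose fan in $\mathbb{R}^2$ has rays generated by $$u_0 = -e_2, \quad u_1 = e_1, \quad u_2 = e_2, \quad u_3 = -e_1 + r\, e_2,$$ and two-dimensional cones $\operatorname{Cone}(u_i, u_{i+1})$ for $i \in \{0,1,2,3\}$ (with $u_4 = u_0$). For each $i$, $D_i$ is the torus-invariant prime divisor corresponding to the ray $\operatorname{Cone}(u_i)$. Thus $D_1$ and $D_3$ are the fibres of $\pi$ over $0$ and $\infty$ in $\mathbb{P}^1 = \mathbb{C} \cup \{\infty\}$, and $D_0$, $D_2$ are disjoint sections of $\pi$ with $D_0 \cdot D_0 = r$ and $D_2 \cdot D_2 = -r$. *)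

(* Defs.v *)
From HB Require Import structures.
From mathcomp Require Import all_boot all_order all_algebra.
From mathcomp Require Import mpoly ring zify.

Set Implicit Arguments.
Unset Strict Implicit.
Unset Printing Implicit Defensive.

Import GRing.Theory.
Local Open Scope ring_scope.

(* The toric surface X of the fan below is treated as a classical variety over
   an algebraically closed field k: four affine planes, one for each maximal
   cone, glued along the open subsets attached to the common faces.  Divisors
   are Cartier divisors, and ampleness is defined through projective
   embeddings: D is ample if some positive multiple mD is very ample, i.e. if
   finitely many global sections of O_X(mD) define a closed embedding of X
   into a projective space. *)

Definition lattice := (int * int)%type.

Definition pairing (m u : lattice) : int := m.1 * u.1 + m.2 * u.2.

Definition fan_ray (r : nat) (i : 'I_4) : lattice :=
  nth (0, 0) [:: (0, -1); (1, 0); (0, 1); (-1, r%:Z)] i.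

(* The cone i is Cone(u_i, u_(i+1)), indices modulo 4; [edge i c], c < 2, is
   the index of its c-th ray. *)
Definition edge (i : 'I_4) (c : 'I_2) : 'I_4 := inZp (i + c).

Definition in_cone (i rho : 'I_4) : bool := [exists c, edge i c == rho].

(* The basis of M dual to the basis (u_i, u_(i+1)) of N; these formulas are the
   dual basis because det(u_i, u_(i+1)) = 1 for the four cones (see
   [pairing_dual] below). *)
Definition dual_basis (r : nat) (i : 'I_4) (c : 'I_2) : lattice :=
  let u := fan_ray r (edge i 0) in
  let v := fan_ray r (edge i 1) in
  if c == 0 then (v.2, - v.1) else (- u.2, u.1).

Lemma pairing_dual (r : nat) (i : 'I_4) (c d : 'I_2) :
  pairing (dual_basis r i c) (fan_ray r (edge i d)) = (c == d)%:Z.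
Proof.
rewrite /pairing; case: i => -[|[|[|[|//]]]] hi; case: c => -[|[|//]] hc;
by case: d => -[|[|//]] hd; rewrite /dual_basis /fan_ray /=; lia.
Qed.

Lemma lattice_dual (r : nat) (i : 'I_4) (m : lattice) :
  let e c := pairing m (fan_ray r (edge i c)) in
  let b := dual_basis r i in
  m = (e 0 * (b 0).1 + e 1 * (b 1).1, e 0 * (b 0).2 + e 1 * (b 1).2).
Proof.
case: m => a b; rewrite /pairing; case: i => -[|[|[|[|//]]]] hi;
by rewrite /dual_basis /fan_ray /=; congr pair; ring.
Qed.

(* The point v of the affine plane of the cone i, in the coordinates given by
   the dual basis. *)
Definition chart_point (k : closedFieldType) := ('I_4 * ('I_2 -> k))%type.

(* The value at a point of the character m, computed in the chart of the point;
   meaningful when [pairing m u] is nonnegative for each ray u of the cone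
   whose coordinate vanishes. *)
Definition char_value (k : closedFieldType) (r : nat) (p : chart_point k)
    (m : lattice) : k :=
  \prod_(c < 2) p.2 c ^ pairing m (fan_ray r (edge p.1 c)).

(* The open subset of the chart of p attached to the common face of the cones
   p.1 and j is where the coordinates of the rays that are not in the cone j
   do not vanish. *)
Definition in_overlap (k : closedFieldType) (p : chart_point k) (j : 'I_4) :
    Prop :=
  forall c, ~~ in_cone j (edge p.1 c) -> p.2 c != 0.

(* p and q represent the same point of X: both lie in the affine toric variety
   U_tau of the common face tau, and they give the same homomorphism from the
   semigroup of tau, i.e. the lattice points of its dual cone, to k. *)
Definition same_point (k : closedFieldType) (r : nat) (p q : chart_point k) :
    Prop :=
  [/\ in_overlap p q.1, in_overlap q p.1 &
   forall m : lattice,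
     (forall rho, in_cone p.1 rho -> in_cone q.1 rho ->
        (0 <= pairing m (fan_ray r rho))%R) ->
     char_value r p m = char_value r q m].

Definition zariski_closed (k : closedFieldType) (r : nat)
    (Z : chart_point k -> Prop) : Prop :=
  (forall p q, same_point r p q -> Z p -> Z q) /\
  (forall i, exists I : {mpoly k[2]} -> Prop,
     forall v, Z (i, v) <-> (forall P, I P -> P.@[v] = 0)).

Notation funfield k := {fraction {mpoly k[2]}}.

Definition ffconst (k : closedFieldType) (c : k) : funfield k :=
  tofrac (c%:MP_[2]).

Definition ffvar (k : closedFieldType) (c : 'I_2) : funfield k :=
  tofrac ('X_c : {mpoly k[2]}).

Definition character (k : closedFieldType) (m : lattice) : funfield k :=
  ffvar k 0 ^ m.1 * ffvar k 1 ^ m.2.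

Definition coord (k : closedFieldType) (r : nat) (i : 'I_4) (c : 'I_2) :
    funfield k :=
  character k (dual_basis r i c).

(* Substitution of the coordinates of the chart i; its image is the coordinate
   ring of that chart. *)
Definition chart_fun (k : closedFieldType) (r : nat) (i : 'I_4)
    (P : {mpoly k[2]}) : funfield k :=
  mmap (@ffconst k) (coord k r i) P.

(* f belongs to the local ring of X at p *)
Definition regular_at (k : closedFieldType) (r : nat) (p : chart_point k)
    (f : funfield k) : Prop :=
  exists P Q : {mpoly k[2]},
    Q.@[p.2] != 0 /\ f = chart_fun r p.1 P / chart_fun r p.1 Q.

Definition unit_at (k : closedFieldType) (r : nat) (p : chart_point k)
    (f : funfield k) : Prop :=
  [/\ f != 0, regular_at r p f & regular_at r p f^-1].

(* Every Cartier divisor of X is of this form, since the Picard group of each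
   chart is trivial. *)
Record cartier (k : closedFieldType) (r : nat) := Cartier {
  local_eq :> 'I_4 -> funfield k;
  local_eq_neq0 : forall i, local_eq i != 0;
  local_eq_glue : forall p q : chart_point k, same_point r p q ->
    unit_at r p (local_eq p.1 / local_eq q.1) }.

Section LocalRings.
Variables (k : closedFieldType) (r : nat).
Implicit Types (p q : chart_point k) (f g : funfield k) (m : lattice).

Lemma ffconst_is_zmod_morphism : zmod_morphism (@ffconst k).
Proof. by move=> a b; rewrite /ffconst rmorphB /= rmorphB. Qed.

Lemma ffconst_is_monoid_morphism : monoid_morphism (@ffconst k).
Proof. by split=> [|a b]; rewrite /ffconst ?rmorph1 // !rmorphM. Qed.

HB.instance Definition _ := GRing.isZmodMorphism.Build _ _ (@ffconst k)
  ffconst_is_zmod_morphism.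
HB.instance Definition _ := GRing.isMonoidMorphism.Build _ _ (@ffconst k)
  ffconst_is_monoid_morphism.

Lemma chart_funM i : {morph @chart_fun k r i : P Q / P * Q}.
Proof. by move=> P Q; rewrite /chart_fun rmorphM. Qed.

Lemma chart_fun1 i : @chart_fun k r i 1 = 1.
Proof. exact: rmorph1. Qed.

Lemma chart_funX i c : @chart_fun k r i 'X_c = coord k r i c.
Proof. by rewrite /chart_fun mmapX mmap1U. Qed.

Lemma regular_atM p f g :
  regular_at r p f -> regular_at r p g -> regular_at r p (f * g).
Proof.
move=> [P [Q [Q0 ->]]] [P' [Q' [Q'0 ->]]]; exists (P * P'), (Q * Q').
by rewrite mevalM mulf_neq0 // !chart_funM invfM mulrACA.
Qed.

Lemma unit_atM p f g : unit_at r p f -> unit_at r p g -> unit_at r p (f * g).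
Proof.
move=> [f0 hf hf'] [g0 hg hg']; split; first by rewrite mulf_neq0.
  exact: regular_atM.
by rewrite invfM; apply: regular_atM.
Qed.

Lemma unit_at1 p : unit_at r p 1.
Proof.
have h : regular_at r p 1.
  by exists 1, 1; rewrite meval1 oner_neq0 chart_fun1 divr1.
by split; rewrite ?oner_neq0 ?invr1.
Qed.

Lemma unit_atV p f : unit_at r p f -> unit_at r p f^-1.
Proof. by case=> f0 h1 h2; split; rewrite ?invr_eq0 ?invrK. Qed.

Lemma unit_atXn p f n : unit_at r p f -> unit_at r p (f ^+ n).
Proof.
move=> hf; elim: n => [|n IHn]; first by rewrite expr0; apply: unit_at1.
by rewrite exprS; apply: unit_atM.
Qed.

Lemma unit_atXz p f (n : int) : unit_at r p f -> unit_at r p (f ^ n).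
Proof.
by move=> hf; case: n => n; [|apply: unit_atV]; apply: unit_atXn.
Qed.

Lemma ffvar_neq0 c : ffvar k c != 0.
Proof.
rewrite /ffvar tofrac_eq0; apply/eqP=> /(congr1 (fun P => P.@[fun=> 1])).
by rewrite mevalXU meval0 => /eqP; rewrite oner_eq0.
Qed.

Lemma character_neq0 m : character k m != 0.
Proof. by rewrite mulf_neq0 // expfz_neq0 // ffvar_neq0. Qed.

Lemma characterD m m' :
  character k (m.1 + m'.1, m.2 + m'.2) = character k m * character k m'.
Proof. by rewrite /character /= !expfzDr ?ffvar_neq0 // mulrACA. Qed.

Lemma characterV m : (character k m)^-1 = character k (- m.1, - m.2).
Proof. by rewrite /character invfM !invr_expz. Qed.

Lemma characterXz m (n : int) :
  character k m ^ n = character k (n * m.1, n * m.2).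
Proof. by rewrite /character expfzMl !exprz_exp /= ![n * _]mulrC. Qed.

Lemma coord_unit p c : p.2 c != 0 -> unit_at r p (coord k r p.1 c).
Proof.
move=> vc; split; first exact: character_neq0.
  exists 'X_c, 1; rewrite meval1 oner_neq0 chart_fun1 divr1.
  by rewrite chart_funX.
by exists 1, 'X_c; rewrite mevalXU chart_fun1 div1r chart_funX.
Qed.

Lemma character_unit p m :
  (forall c, p.2 c = 0 -> pairing m (fan_ray r (edge p.1 c)) = 0) ->
  unit_at r p (character k m).
Proof.
move=> h; rewrite (lattice_dual r p.1 m) /=.
set e := fun c => pairing m (fan_ray r (edge p.1 c)).
have := characterD (e 0 * (dual_basis r p.1 0).1, e 0 * (dual_basis r p.1 0).2)
  (e 1 * (dual_basis r p.1 1).1, e 1 * (dual_basis r p.1 1).2).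
rewrite /= => ->.
rewrite -(characterXz (dual_basis r p.1 0)) -(characterXz (dual_basis r p.1 1)).
have hc c : unit_at r p (coord k r p.1 c ^ e c).
  have [/h ec|vc] := eqVneq (p.2 c) 0.
    by rewrite /e ec expr0z; apply: unit_at1.
  exact/unit_atXz/coord_unit.
by apply: unit_atM; apply: hc.
Qed.

Lemma character_glue (s : 'I_4 -> lattice) :
  (forall i j rho, in_cone i rho -> in_cone j rho ->
     pairing (s i) (fan_ray r rho) = pairing (s j) (fan_ray r rho)) ->
  forall p q, same_point r p q ->
    unit_at r p (character k (s p.1) / character k (s q.1)).
Proof.
move=> hs p q [hp _ _].
rewrite characterV -characterD; apply: character_unit => c vc.
have hc : in_cone q.1 (edge p.1 c).
  by apply: contraT => /hp; rewrite vc eqxx.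
have hc' : in_cone p.1 (edge p.1 c) by apply/existsP; exists c.
have := hs _ _ _ hc' hc; rewrite /pairing /= => h.
by rewrite !mulrDl addrACA !mulNr -opprD h subrr.
Qed.

Lemma glueM (D E : cartier k r) p q : same_point r p q ->
  unit_at r p ((D p.1 * E p.1) / (D q.1 * E q.1)).
Proof.
move=> h; rewrite invfM mulrACA.
by apply: unit_atM; apply: local_eq_glue.
Qed.

Lemma glueV (D : cartier k r) p q : same_point r p q ->
  unit_at r p ((D p.1)^-1 / (D q.1)^-1).
Proof. by move=> h; rewrite -invfM; apply/unit_atV/local_eq_glue. Qed.

Lemma glue1 p q : same_point r p q -> unit_at r p (1 / 1).
Proof. by move=> _; rewrite divr1; apply: unit_at1. Qed.

End LocalRings.

Section Operations.
Variables (k : closedFieldType) (r : nat).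

Definition cartier0 : cartier k r :=
  @Cartier k r (fun=> 1) (fun=> oner_neq0 _) (@glue1 k r).

Definition cartier_add (D E : cartier k r) : cartier k r :=
  @Cartier k r (fun i => D i * E i)
    (fun i => mulf_neq0 (local_eq_neq0 D i) (local_eq_neq0 E i))
    (@glueM k r D E).

Definition cartier_opp (D : cartier k r) : cartier k r :=
  @Cartier k r (fun i => (D i)^-1)
    (fun i => invr_neq0 (local_eq_neq0 D i)) (@glueV k r D).

Definition cartier_mul (D : cartier k r) (n : nat) : cartier k r :=
  iter n (cartier_add D) cartier0.

End Operations.

Declare Scope cartier_scope.
Delimit Scope cartier_scope with CD.
Bind Scope cartier_scope with cartier.
Notation "D + E" := (cartier_add D E) : cartier_scope.
Notation "- D" := (cartier_opp D) : cartier_scope.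
Notation "D *+ n" := (cartier_mul D n) : cartier_scope.

(* D_rho is the closure of the orbit of the ray rho: it misses the chart i if
   rho is not in the cone i, and is otherwise the zero locus of the coordinate
   dual to u_rho. *)
Definition torus_div_eq (k : closedFieldType) (r : nat) (rho i : 'I_4) :
    funfield k :=
  \prod_(c < 2 | edge i c == rho) coord k r i c.

Section TorusDivisors.
Variables (k : closedFieldType) (r : nat) (rho : 'I_4).

Let weight (i : 'I_4) : lattice :=
  let t (c : 'I_2) : int := (edge i c == rho)%:Z in
  let b := dual_basis r i in
  (t 0 * (b 0).1 + t 1 * (b 1).1, t 0 * (b 0).2 + t 1 * (b 1).2).

Lemma torus_div_eqE i : torus_div_eq k r rho i = character k (weight i).
Proof.
have := characterD k
  ((edge i 0 == rho)%:Z * (dual_basis r i 0).1,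
   (edge i 0 == rho)%:Z * (dual_basis r i 0).2)
  ((edge i 1 == rho)%:Z * (dual_basis r i 1).1,
   (edge i 1 == rho)%:Z * (dual_basis r i 1).2).
rewrite /= => h; rewrite [RHS]h {h}.
rewrite -(characterXz k (dual_basis r i 0)) -(characterXz k (dual_basis r i 1)).
rewrite /torus_div_eq.
rewrite big_mkcond /= big_ord_recl big_ord1.
have -> : lift ord0 ord0 = 1 :> 'I_2 by apply: val_inj.
by congr (_ * _); case: eqP => _; rewrite ?expr0z ?expr1z.
Qed.

Lemma torus_div_eq_neq0 i : torus_div_eq k r rho i != 0.
Proof. by rewrite torus_div_eqE character_neq0. Qed.

Lemma pairing_weight i sigma : in_cone i sigma ->
  pairing (weight i) (fan_ray r sigma) = (sigma == rho)%:Z.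
Proof.
case/existsP=> c /eqP <-.
transitivity (\sum_(d < 2) (edge i d == rho)%:Z *
                pairing (dual_basis r i d) (fan_ray r (edge i c))).
  rewrite big_ord_recl big_ord1.
  have -> : lift ord0 ord0 = 1 :> 'I_2 by apply: val_inj.
  by rewrite /pairing /=; ring.
rewrite (bigD1 c) //= pairing_dual eqxx mulr1 big1 ?addr0 // => d /negPf dc.
by rewrite pairing_dual dc mulr0.
Qed.

Lemma torus_div_glue (p q : chart_point k) : same_point r p q ->
  unit_at r p (torus_div_eq k r rho p.1 / torus_div_eq k r rho q.1).
Proof.
rewrite !torus_div_eqE; apply: character_glue => i j sigma hi hj.
by rewrite !pairing_weight.
Qed.

Definition torus_div : cartier k r :=
  @Cartier k r (torus_div_eq k r rho) torus_div_eq_neq0 torus_div_glue.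

End TorusDivisors.

(* The partial derivative of a rational function, by the quotient rule. *)
Definition ffderiv (k : closedFieldType) (c : 'I_2) (f : funfield k) :
    funfield k :=
  let P := (frac (repr f)).1 in
  let Q := (frac (repr f)).2 in
  (tofrac P^`M(c) * tofrac Q - tofrac P * tofrac Q^`M(c)) / tofrac Q ^+ 2.

Definition jacobian (k : closedFieldType) (f g : funfield k) : funfield k :=
  ffderiv 0 f * ffderiv 1 g - ffderiv 1 f * ffderiv 0 g.

(* Let omega = w dx /\ dy, where x and y are the two variables of the function
   field.  If (a, b) are the coordinates of the chart i, da /\ db generates the
   2-forms of the chart, and da /\ db = J dx /\ dy, J being their jacobian;
   hence w / J is a local equation of div(omega). *)
Definition form_div_eq (k : closedFieldType) (r : nat) (w : funfield k)
    (i : 'I_4) : funfield k :=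
  w / jacobian (coord k r i 0) (coord k r i 1).

Lemma quotient_rule_indep (F : fieldType) (p q n d p' q' n' d' : F) :
  q != 0 -> d != 0 -> n * q = p * d -> n' * q + n * q' = p' * d + p * d' ->
  (n' * d - n * d') / d ^+ 2 = (p' * q - p * q') / q ^+ 2.
Proof.
move=> q0 d0 hn hn'; have en : n = p * d / q by rewrite -hn mulfK.
have en' : n' = (p' * d + p * d' - n * q') / q by rewrite -hn' addrK mulfK.
by rewrite en' en; field; rewrite q0 d0.
Qed.

Lemma quotient_rule_mul (F : fieldType) (p q n d p' q' n' d' : F) :
  q != 0 -> d != 0 ->
  ((p' * n + p * n') * (q * d) - (p * n) * (q' * d + q * d')) / (q * d) ^+ 2 =
  (p' * q - p * q') / q ^+ 2 * (n / d) + p / q * ((n' * d - n * d') / d ^+ 2).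
Proof. by move=> q0 d0; field; rewrite q0 d0. Qed.

Section Derivation.
Variables (k : closedFieldType) (c : 'I_2).
Implicit Types f g : funfield k.

Lemma ffE f : f = tofrac (frac (repr f)).1 / tofrac (frac (repr f)).2.
Proof.
have hd : tofrac (frac (repr f)).2 != 0 by rewrite tofrac_eq0 denom_ratioP.
apply: (canRL (mulfK hd)); rewrite -{1}(reprK f).
case: (repr f) => -[n d] /= d0; unlock tofrac.
rewrite -[LHS]FracField.pi_mul; apply/eqmodP.
rewrite /= FracField.equivfE /mulf /= !numden_Ratio ?mulr1 ?oner_eq0 //.
by rewrite mulrC.
Qed.

Lemma ffderivE (P Q : {mpoly k[2]}) : Q != 0 ->
  ffderiv c (tofrac P / tofrac Q) =
  (tofrac P^`M(c) * tofrac Q - tofrac P * tofrac Q^`M(c)) / tofrac Q ^+ 2.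
Proof.
move=> Q0; have tQ : tofrac Q != 0 by rewrite tofrac_eq0.
rewrite /ffderiv; move: (denom_ratioP (repr (tofrac P / tofrac Q))).
move: (ffE (tofrac P / tofrac Q)); case: (frac (repr _)) => n d.
rewrite [(n, d).1]/= [(n, d).2]/= => hf d0.
have td : tofrac d != 0 by rewrite tofrac_eq0.
have htn : tofrac n * tofrac Q = tofrac P * tofrac d.
  by apply/eqP; rewrite -(eqr_div (tofrac n) (tofrac P) td tQ) hf.
have /(congr1 (fun A => tofrac A^`M(c))) : n * Q = P * d.
  by apply/eqP; rewrite -tofrac_eq !tofracM htn.
rewrite !mderivM !tofracD !tofracM => h.
exact: (quotient_rule_indep tQ td htn h).
Qed.

Lemma ffderivM f g : ffderiv c (f * g) = ffderiv c f * g + f * ffderiv c g.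
Proof.
move: (ffE f) (ffE g) (denom_ratioP (repr f)) (denom_ratioP (repr g)).
move: (frac (repr f)).1 (frac (repr f)).2 => P Q.
move: (frac (repr g)).1 (frac (repr g)).2 => N D -> -> Q0 D0.
have QD0 : Q * D != 0 by rewrite mulf_neq0.
rewrite mulrACA -invfM -(tofracM P) -(tofracM Q).
rewrite (ffderivE _ QD0) (ffderivE _ Q0) (ffderivE _ D0).
rewrite !mderivM !tofracD !tofracM.
by apply: quotient_rule_mul; rewrite tofrac_eq0.
Qed.

Lemma ffderiv_poly (P : {mpoly k[2]}) : ffderiv c (tofrac P) = tofrac P^`M(c).
Proof.
rewrite -[tofrac P]divr1 -tofrac1 ffderivE ?oner_neq0 // mderivC.
by rewrite tofrac1 tofrac0 mulr1 mulr0 subr0 expr1n divr1.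
Qed.

Let dlog f := ffderiv c f / f.

Lemma dlogM f g : f != 0 -> g != 0 -> dlog (f * g) = dlog f + dlog g.
Proof.
move=> f0 g0; rewrite /dlog ffderivM mulrDl; congr (_ + _).
  by rewrite invfM mulrACA divff // mulr1.
by rewrite invfM mulrACA divff // mul1r.
Qed.

Lemma dlog1 : dlog 1 = 0.
Proof. by rewrite /dlog -tofrac1 ffderiv_poly mderivC tofrac0 mul0r. Qed.

Lemma dlogXn f n : f != 0 -> dlog (f ^+ n) = n%:R * dlog f.
Proof.
move=> f0; elim: n => [|n IHn]; first by rewrite dlog1 mul0r.
by rewrite exprS dlogM ?expf_neq0 // IHn -[n.+1]add1n natrD mulrDl mul1r.
Qed.

Lemma dlogXz f (n : int) : f != 0 -> dlog (f ^ n) = n%:~R * dlog f.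
Proof.
move=> f0; case: n => n; first by rewrite -exprnP dlogXn.
rewrite NegzE -exprnN mulrNz mulNr -dlogXn //; apply/eqP.
have fn0 : f ^+ n.+1 != 0 by rewrite expf_neq0.
by rewrite -addr_eq0 -dlogM ?invr_eq0 // mulVf // dlog1.
Qed.

Lemma dlog_ffvar d : dlog (ffvar k d) = (d == c)%:R / ffvar k c.
Proof.
rewrite /dlog /ffvar ffderiv_poly mderivX mnmE.
have [->|_] := eqVneq d c; last by rewrite scale0r tofrac0 !mul0r.
rewrite scale1r (_ : (U_(c) - U_(c))%MM = 0%MM) ?mpolyX0 ?tofrac1 //.
by apply/mnmP=> j; rewrite mnmBE mnm0E subnn.
Qed.

Lemma ffderiv_character m :
  ffderiv c (character k m) =
  character k m * ((if c == 0 then m.1 else m.2)%:~R / ffvar k c).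
Proof.
have m0 := character_neq0 k m; rewrite mulrC.
apply: (canRL (mulfVK m0)); rewrite -[LHS]/(dlog _) /character.
rewrite dlogM ?expfz_neq0 ?ffvar_neq0 // !dlogXz ?ffvar_neq0 // !dlog_ffvar.
case: (c) => -[|[|//]] hc /=; rewrite ?mul0r ?mulr0 ?addr0 ?add0r.
  by rewrite mul1r.
by rewrite mul1r.
Qed.

End Derivation.

Lemma jacobian_det (F : fieldType) (x y a b m1 m2 n1 n2 : F) :
  x != 0 -> y != 0 -> m1 * n2 - m2 * n1 = 1 ->
  a * (m1 / x) * (b * (n2 / y)) - a * (m2 / y) * (b * (n1 / x)) =
  a * b * (x * y)^-1.
Proof.
move=> x0 y0 h; rewrite -[RHS]mul1r -h; field.
by rewrite x0 y0.
Qed.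

Lemma divf_cancell (F : fieldType) (x a b : F) :
  x != 0 -> x / a / (x / b) = (a / b)^-1.
Proof. by move=> x0; rewrite !invfM !invrK mulrACA divff // mul1r. Qed.

Section CanonicalDivisors.
Variables (k : closedFieldType) (r : nat) (w : funfield k).
Hypothesis w_neq0 : w != 0.

Let weight (i : 'I_4) : lattice :=
  let b := dual_basis r i in
  ((b 0).1 + (b 1).1 - 1, (b 0).2 + (b 1).2 - 1).

Lemma form_div_eqE i : form_div_eq r w i = w / character k (weight i).
Proof.
rewrite /form_div_eq; congr (w / _); rewrite /jacobian !ffderiv_character /=.
have -> : character k (weight i) = coord k r i 0 * coord k r i 1 *
    (ffvar k 0 * ffvar k 1)^-1.
  rewrite /coord -characterD /character /= !expfzDr ?ffvar_neq0 //.
  by rewrite !exprN1 invfM mulrACA.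
have := ffvar_neq0 k 0; have := ffvar_neq0 k 1.
move: (ffvar k 0) (ffvar k 1) => x y y0 x0.
have hdet : (dual_basis r i 0).1 * (dual_basis r i 1).2 -
    (dual_basis r i 0).2 * (dual_basis r i 1).1 = 1.
  by case: i => -[|[|[|[|//]]]] hi; rewrite /dual_basis /fan_ray /=; lia.
rewrite /coord; move: (character k _) (character k _) => a b.
move/(congr1 (fun n : int => n%:~R : funfield k)): hdet.
rewrite rmorphB !rmorphM /=.
exact: jacobian_det.
Qed.

Lemma form_div_eq_neq0 i : form_div_eq r w i != 0.
Proof.
by rewrite form_div_eqE mulf_neq0 ?invr_eq0 ?character_neq0.
Qed.

Lemma pairing_form_weight i sigma : in_cone i sigma ->
  pairing (weight i) (fan_ray r sigma) = 1 - pairing (1, 1) (fan_ray r sigma).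
Proof.
case/existsP=> c /eqP <-.
transitivity (\sum_(d < 2) pairing (dual_basis r i d) (fan_ray r (edge i c)) -
              pairing (1, 1) (fan_ray r (edge i c))).
  rewrite big_ord_recl big_ord1.
  have -> : lift ord0 ord0 = 1 :> 'I_2 by apply: val_inj.
  by rewrite /pairing /=; ring.
congr (_ - _); rewrite (bigD1 c) //= pairing_dual eqxx big1 ?addr0 //.
by move=> d /negPf dc; rewrite pairing_dual dc.
Qed.

Lemma form_div_glue (p q : chart_point k) : same_point r p q ->
  unit_at r p (form_div_eq r w p.1 / form_div_eq r w q.1).
Proof.
move=> pq; rewrite !form_div_eqE divf_cancell //; apply: unit_atV.
apply: character_glue pq => i j sigma hi hj.
by rewrite !pairing_form_weight.
Qed.

Definition form_div : cartier k r :=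
  @Cartier k r (form_div_eq r w) form_div_eq_neq0 form_div_glue.

End CanonicalDivisors.

Definition canonical_divisor (k : closedFieldType) (r : nat)
    (K : cartier k r) : Prop :=
  exists (w : funfield k) (w_neq0 : w != 0), K = form_div r w_neq0.

(* For nonzero y and z: they represent the same point of P^N. *)
Definition proportional (k : closedFieldType) (N : nat) (y z : 'I_N.+1 -> k) :
    Prop :=
  exists2 a : k, a != 0 & forall c, y c = a * z c.

Definition proj_closed (k : closedFieldType) (N : nat)
    (W : ('I_N.+1 -> k) -> Prop) : Prop :=
  exists I : {mpoly k[N.+1]} -> Prop,
    (forall G, I G -> exists d : nat, G \is d.-homog) /\
    (forall y, (exists c, y c != 0) -> W y <-> (forall G, I G -> G.@[y] = 0)).

(* The rational functions s_0, ..., s_N are global sections of O_X(D), with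
   div(s_c) + D effective: P i c is the polynomial expressing s_c, relative to
   the generator 1 / D_i of O_X(D), in the coordinates of the chart i. *)
Definition global_sections (k : closedFieldType) (r : nat) (D : cartier k r)
    (N : nat) (s : 'I_N.+1 -> funfield k)
    (P : 'I_4 -> 'I_N.+1 -> {mpoly k[2]}) : Prop :=
  forall i c, s c * D i = chart_fun r i (P i c).

(* Homogeneous coordinates of the image of p under the map given by the
   sections. *)
Definition proj_image (k : closedFieldType) (N : nat)
    (P : 'I_4 -> 'I_N.+1 -> {mpoly k[2]}) (p : chart_point k) : 'I_N.+1 -> k :=
  fun c => (P p.1 c).@[p.2].

(* The sections have no common zero, hence define a morphism phi from X to P^N,
   and phi is a closed embedding: it is injective and closed (being continuous,
   it is thus a homeomorphism onto a closed subset), and the local ring of P^N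
   at phi(p) maps onto the local ring of X at p. *)
Definition closed_embedding (k : closedFieldType) (r N : nat)
    (s : 'I_N.+1 -> funfield k) (P : 'I_4 -> 'I_N.+1 -> {mpoly k[2]}) : Prop :=
  [/\ forall p, exists c, proj_image P p c != 0,
      forall p q, proportional (proj_image P p) (proj_image P q) ->
        same_point r p q,
      forall Z, zariski_closed r Z ->
        proj_closed (fun y => exists2 p, Z p & proportional y (proj_image P p))
    & forall p f, regular_at r p f ->
        exists (d : nat) (G H : {mpoly k[N.+1]}),
          [/\ G \is d.-homog, H \is d.-homog, H.@[proj_image P p] != 0 &
             f = mmap (@ffconst k) s G / mmap (@ffconst k) s H]].

Definition very_ample (k : closedFieldType) (r : nat) (D : cartier k r) :
    Prop :=
  exists (N : nat) (s : 'I_N.+1 -> funfield k)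
         (P : 'I_4 -> 'I_N.+1 -> {mpoly k[2]}),
    global_sections D s P /\ closed_embedding r s P.

Definition ample (k : closedFieldType) (r : nat) (D : cartier k r) : Prop :=
  exists2 m : nat, (0 < m)%N & very_ample (D *+ m).

(* Main.v *)
Require Import Defs.
From mathcomp Require Import all_boot all_order all_algebra.
From mathcomp Require Import complex reals.
From mathcomp Require Import mpoly ring zify.
From Stdlib Require Import FunctionalExtensionality.

(** Let L be a divisor linearly equivalent to the sum of the a_i D_i.  The proof
rests on the criterion [ample_toric]: L is ample if and only if its degrees
a_0 + a_2 on D_1 and a_1 + a_3 - r a_2 on D_2 are positive.  The divisor -K is
equivalent to 2 D_0 + (2 - r) D_3, so for each D of the theorem the criterion
is an inequality on r.

The degrees of an ample divisor are positive because a multiple mL of L is very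
ample.  Restricted to an invariant curve, a section of mL is a polynomial P(x)
in one chart and Q(1/x) in the next, with P(x) = x^n Q(1/x) for x != 0, where n
is the degree of mL on the curve.  If n <= 0 then P is constant
([const_on_curve]), so all sections take the same values at two different
points of the curve, against injectivity ([very_ample_degree_gt0]).

Conversely, if both degrees are positive, so are those on D_3 and D_0, and L
itself is very ample ([very_ample_sections]).  A local equation of L on the
chart i is a character s_i, up to a common factor; the lattice points -s_i are
the vertices of the polygon of L.  The sections used are the characters of the
four vertices and of the eight lattice points next to a vertex along an edge.
On the chart i the vertex section i has no zero, and the quotients by it of its
two neighbours are the coordinates of the chart.  By strict convexity of
the polygon, the vertex section i vanishes outside the chart i
([phi_vtx_overlap]), which gives injectivity ([proportional_phi]) and, by
homogenizing polynomials, surjectivity on local rings ([phi_local]).  The image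
of a closed set Z is closed ([phi_closed]): it is defined by all homogeneous
polynomials that vanish on it.  Binomial relations among the sections force a
common zero y of these polynomials to have a nonzero vertex coordinate
([exists_vtx_neq0]) and to be the image of a point of the corresponding chart
([phi_recover]); the homogenized equations of Z on that chart put the point in
Z. *)

Set Implicit Arguments.
Unset Strict Implicit.
Unset Printing Implicit Defensive.

Import Order.TTheory GRing.Theory Num.Theory.
Local Open Scope ring_scope.

(** * Rays, characters and fractions *)

Lemma pairingD m m' u : pairing (m + m') u = pairing m u + pairing m' u.
Proof. by rewrite /pairing /=; ring. Qed.

Lemma pairingN m u : pairing (- m) u = - pairing m u.
Proof. by rewrite /pairing /=; ring. Qed.

Lemma ord2P (c : 'I_2) : c = 0 \/ c = 1.
Proof. by case: c => -[|[|//]] hc; [left|right]; apply: val_inj. Qed.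

Lemma big_ord2 (T : Type) (idx : T) (op : Monoid.law idx) (F : 'I_2 -> T) :
  \big[op/idx]_(c < 2) F c = op (F 0) (F 1).
Proof.
rewrite big_ord_recl big_ord1; congr (op _ (F _)).
exact: val_inj.
Qed.

Lemma in_cone_edge i c : in_cone i (edge i c).
Proof. by apply/existsP; exists c. Qed.

Lemma lattice_ext r i (m m' : lattice) :
  (forall c, pairing m (fan_ray r (edge i c)) =
             pairing m' (fan_ray r (edge i c))) -> m = m'.
Proof. by move=> h; rewrite (lattice_dual r i m) /= !h -lattice_dual. Qed.

(** The values of m on the two rays of a cone are its coordinates in the dual
    basis. *)
Lemma pairing_dual_decomp r i m u :
  pairing m u =
    pairing (dual_basis r i 0) u * pairing m (fan_ray r (edge i 0)) +
    pairing (dual_basis r i 1) u * pairing m (fan_ray r (edge i 1)).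
Proof. by rewrite {1}(lattice_dual r i m) /pairing /=; ring. Qed.

Lemma pairing0 u : pairing 0 u = 0.
Proof. by rewrite /pairing /= !mul0r. Qed.

Lemma pairingB m m' u : pairing (m - m') u = pairing m u - pairing m' u.
Proof. by rewrite pairingD pairingN. Qed.

Lemma pairingMn m n u : pairing (m *+ n) u = n%:Z * pairing m u.
Proof.
elim: n => [|n IHn]; first by rewrite mulr0n pairing0 mul0r.
by rewrite mulrS pairingD IHn; lia.
Qed.

(** The second ray of a cone is the first ray of the next one; the dual bases of
    both cones contain a normal to this common ray, with opposite signs. *)
Lemma edge_next i : edge i 1 = edge (edge i 1) 0.
Proof. by case: i => -[|[|[|[|//]]]] hi; apply: val_inj. Qed.

Lemma dual_next r i : dual_basis r (edge i 1) 1 = - dual_basis r i 0.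
Proof.
case: i => -[|[|[|[|//]]]] hi; rewrite /dual_basis /fan_ray /=;
  by congr pair; ring.
Qed.

Lemma edge_pred i : exists i', i = edge i' 1.
Proof.
exists (inZp (i + 3)); apply: val_inj.
by case: i => -[|[|[|[|//]]]].
Qed.

Lemma ray_cases j' rho (j := edge j' 1) :
  [\/ rho = edge j' 0, rho = edge j 0, rho = edge j 1
    | rho = edge (edge j 1) 1].
Proof.
rewrite {}/j; case: j' => -[|[|[|[|//]]]] hj; case: rho => -[|[|[|[|//]]]] hr;
solve [apply: Or41; exact: val_inj | apply: Or42; exact: val_inj
  | apply: Or43; exact: val_inj | apply: Or44; exact: val_inj].
Qed.

(** * Values of rational functions on the torus *)

Lemma divf_cross (F : fieldType) (a b c d : F) :
  b != 0 -> d != 0 -> a / b = c / d -> a * d = c * b.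
Proof. by move=> b0 d0 /eqP; rewrite eqr_div // => /eqP. Qed.

Section Values.
Variable k : closedFieldType.
Implicit Types (t v : 'I_2 -> k) (f g : funfield k) (P Q : {mpoly k[2]}).

(** The rational function f is defined at the point t of the affine plane, where
    its value is a. *)
Definition value_at t f (a : k) : Prop :=
  exists P Q, [/\ Q.@[t] != 0, f = tofrac P / tofrac Q & a = P.@[t] / Q.@[t]].

Lemma meval_neq0 t Q : Q.@[t] != 0 -> tofrac Q != 0.
Proof.
by apply: contra; rewrite tofrac_eq0 => /eqP->; rewrite meval0.
Qed.

Lemma value_at_inj t f a b : value_at t f a -> value_at t f b -> a = b.
Proof.
move=> [P [Q [Q0 -> ->]]] [P' [Q' [Q'0 h ->]]].
have := divf_cross (meval_neq0 Q0) (meval_neq0 Q'0) h.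
rewrite -(tofracM P) -(tofracM P') => /eqP.
rewrite tofrac_eq => /eqP/(congr1 (meval t)).
by rewrite !mevalM => e; apply/eqP; rewrite eqr_div // e.
Qed.

Lemma value_at_poly t P : value_at t (tofrac P) P.@[t].
Proof. by exists P, 1; rewrite meval1 oner_neq0 tofrac1 !divr1. Qed.

Lemma value_at_const t c : value_at t (ffconst c) c.
Proof. by have := value_at_poly t c%:MP_[2]; rewrite mevalC. Qed.

Lemma value_atD t f g a b :
  value_at t f a -> value_at t g b -> value_at t (f + g) (a + b).
Proof.
move=> [P [Q [Q0 -> ->]]] [P' [Q' [Q'0 -> ->]]].
exists (P * Q' + P' * Q), (Q * Q').
rewrite mevalD !mevalM tofracD !tofracM; split; first exact: mulf_neq0.
  exact: addf_div (meval_neq0 Q0) (meval_neq0 Q'0).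
exact: addf_div.
Qed.

Lemma value_atM t f g a b :
  value_at t f a -> value_at t g b -> value_at t (f * g) (a * b).
Proof.
move=> [P [Q [Q0 -> ->]]] [P' [Q' [Q'0 -> ->]]].
exists (P * P'), (Q * Q'); rewrite !mevalM !tofracM.
by split; [apply: mulf_neq0 | apply: mulf_div | apply: mulf_div].
Qed.

Lemma value_atV t f a : a != 0 -> value_at t f a -> value_at t f^-1 a^-1.
Proof.
move=> a0 [P [Q [Q0 -> ha]]]; exists Q, P; rewrite ha !invf_div.
split; [|reflexivity|reflexivity].
by apply: contra_neq a0 => P0; rewrite ha P0 mul0r.
Qed.

Lemma value_atXn t f a n : value_at t f a -> value_at t (f ^+ n) (a ^+ n).
Proof.
move=> fa; elim: n => [|n IHn]; last by rewrite !exprS; apply: value_atM.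
by have := value_at_poly t 1; rewrite meval1 tofrac1.
Qed.

Lemma value_atXz t f a (n : int) :
  a != 0 -> value_at t f a -> value_at t (f ^ n) (a ^ n).
Proof.
move=> a0 fa; case: n => n; first exact: value_atXn.
by apply: value_atV; rewrite ?expf_neq0 //; apply: value_atXn.
Qed.

Lemma value_at_mmap t (h : 'I_2 -> funfield k) v P :
  (forall c, value_at t (h c) (v c)) ->
  value_at t (mmap (@ffconst k) h P) P.@[v].
Proof.
move=> hv; rewrite /meval /mmap.
apply: (big_ind2 (value_at t)) => [|f a g b|m _].
- by have := value_at_poly t 0; rewrite meval0 tofrac0.
- exact: value_atD.
apply: value_atM; first exact: value_at_const.
by rewrite /mmap1 !big_ord2 /=; apply: value_atM; apply: value_atXn.
Qed.

(** The value of the character m at the point t of the torus. *)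
Definition torus_char t (m : lattice) : k := t 0 ^ m.1 * t 1 ^ m.2.

Lemma value_at_character t m : (forall c, t c != 0) ->
  value_at t (character k m) (torus_char t m).
Proof.
move=> t0; have h c : value_at t (ffvar k c) (t c).
  by have := value_at_poly t 'X_c; rewrite mevalXU.
by apply: value_atM; apply: value_atXz.
Qed.

Lemma horner_mmap (h : 'I_2 -> {poly k}) P (x : k) :
  (mmap polyC h P).[x] = P.@[fun c => (h c).[x]].
Proof.
rewrite /meval /mmap horner_sum; apply: eq_bigr => m _.
by rewrite /mmap1 !big_ord2 /= hornerM hornerC hornerM !horner_exp.
Qed.

Lemma poly_eq_neq0 (p q : {poly k}) :
  (forall x, x != 0 -> p.[x] = q.[x]) -> p = q.
Proof.
move=> h; apply/eqP; rewrite -subr_eq0.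
apply: contraT => pq; have : (p - q) * 'X != 0 by rewrite mulf_neq0 ?polyX_eq0.
move=> /closed_nonrootP[x]; rewrite /root hornerM hornerX hornerD hornerN.
have [->|x0] := eqVneq x 0; first by rewrite mulr0 eqxx.
by rewrite h // subrr mul0r eqxx.
Qed.

(** A polynomial in x that is x^(-N) times a polynomial in 1/x is constant. *)
Lemma poly_const_inv (p q : {poly k}) (N : nat) :
  (forall x, x != 0 -> x ^+ N * p.[x] = q.[x^-1]) -> forall x, p.[x] = p.[0].
Proof.
move=> h x; have [->|p0] := eqVneq p 0; first by rewrite !horner0.
(* r is x^d q(1/x), whose degree is at most d. *)
pose d := size q; pose r := \sum_(i < d) q`_i *: 'X^(d - i).
have e : 'X^(N + d) * p = r.
  apply: poly_eq_neq0 => y y0.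
  rewrite hornerM hornerXn exprD mulrAC h // horner_coef mulr_suml horner_sum.
  apply: eq_bigr => i _; rewrite hornerZ hornerXn -mulrA; congr (_ * _).
  rewrite exprVn mulrC; apply: (canLR (mulfK _)); first exact: expf_neq0.
  by rewrite -exprD subnK // ltnW.
have : ((size ('X^(N + d) * p)%R).-1 <= d)%N.
  rewrite e; have : (size r <= d.+1)%N.
    apply/leq_sizeP => j jd; rewrite coef_sum big1 // => i _.
    rewrite coefZ coefXn; case: eqP => [ji|]; last by rewrite mulr0.
    by have := leq_subr i d; rewrite -ji leqNgt jd.
  by case: (size r).
rewrite mulrC size_mulXn ?p0 //.
move: p0; rewrite -size_poly_gt0 => p0 sp.
have sp1 : (size p <= 1)%N by lia.
by rewrite (size1_polyC sp1) !hornerC.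
Qed.

End Values.

(** * Restriction to the invariant curves *)

Section InvariantCurves.
Variables (k : closedFieldType) (r : nat).
Implicit Types (v : 'I_2 -> k) (P Q : {mpoly k[2]}) (m : lattice).

Lemma meval_ext n (u v : 'I_n -> k) (P : {mpoly k[n]}) :
  u =1 v -> P.@[u] = P.@[v].
Proof.
move=> uv; rewrite !mevalE; apply: eq_bigr => m _; congr (_ * _).
by apply: eq_bigr => i _; rewrite uv.
Qed.

Lemma char_valueE (p : chart_point k) m :
  char_value r p m = p.2 0 ^ pairing m (fan_ray r (edge p.1 0)) *
                     p.2 1 ^ pairing m (fan_ray r (edge p.1 1)).
Proof. by rewrite /char_value big_ord2. Qed.

Lemma char_value_dual (p : chart_point k) c :
  char_value r p (dual_basis r p.1 c) = p.2 c.
Proof.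
rewrite char_valueE !pairing_dual.
by case: (ord2P c) => ->; rewrite ?expr1z ?expr0z ?mul1r ?mulr1.
Qed.

(** The coordinates on the torus, i.e. the values of the characters (1, 0) and
    (0, 1), of the point v of the chart i; meaningful when no v c vanishes. *)
Definition chart_torus (i : 'I_4) v (d : 'I_2) : k :=
  char_value r (i, v) (if d == 0 then (1, 0) else (0, 1)).

Lemma chart_torus_neq0 i v d : (forall c, v c != 0) -> chart_torus i v d != 0.
Proof.
by move=> v0; rewrite /chart_torus char_valueE mulf_neq0 // expfz_neq0.
Qed.

Lemma torus_char_chart i v m : (forall c, v c != 0) ->
  torus_char (chart_torus i v) m = char_value r (i, v) m.
Proof.
move=> v0; rewrite /torus_char /chart_torus !char_valueE /= !expfzMl.
rewrite !exprz_exp mulrACA -!expfzDr //.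
by congr (_ ^ _ * _ ^ _); rewrite /pairing /=; ring.
Qed.

Lemma value_at_chart_fun i j v P : (forall c, v c != 0) ->
  value_at (chart_torus i v) (chart_fun r j P)
    P.@[fun c => char_value r (i, v) (dual_basis r j c)].
Proof.
move=> v0; apply: value_at_mmap => c; rewrite -torus_char_chart //.
by apply: value_at_character => d; apply: chart_torus_neq0.
Qed.

(** The pair (x, y) as a function on 'I_2. *)
Definition pt2 (T : Type) (x y : T) (c : 'I_2) : T := if c == 0 then x else y.

Section Transition.
Variables (D : cartier k r) (g : funfield k) (s : 'I_4 -> lattice).
Hypothesis Ds : forall i, D i = g * character k (s i).

(** The polynomials P and Q that express a section f of O_X(D) in the charts i
    and j differ by the change of coordinates and the transition function of
    O_X(D). *)
Lemma section_transition f i j v P Q : (forall c, v c != 0) ->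
  f * D i = chart_fun r i P -> f * D j = chart_fun r j Q ->
  P.@[v] = Q.@[fun c => char_value r (i, v) (dual_basis r j c)] *
           char_value r (i, v) (s i - s j).
Proof.
move=> v0 hP hQ.
have e : chart_fun r i P = chart_fun r j Q * character k (s i - s j).
  rewrite -hP -hQ !Ds.
  have -> : character k (s i) = character k (s j) * character k (s i - s j).
    by rewrite -characterD; congr character; case: (s i) => a b; congr pair;
      rewrite /= addrC subrK.
  by rewrite !mulrA.
have := value_at_chart_fun i i P v0; rewrite e => h1.
have h2 : value_at (chart_torus i v) (character k (s i - s j))
    (char_value r (i, v) (s i - s j)).
  rewrite -torus_char_chart //; apply: value_at_character => d.
  exact: chart_torus_neq0.
have := value_at_inj h1 (value_atM (value_at_chart_fun i j Q v0) h2).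
by move=> <-; apply: meval_ext => c; rewrite (char_value_dual (i, v)).
Qed.

(** The curve of the ray common to the cones i and i + 1 is the zero locus of
    the second coordinate of the chart i; the integer required to be nonpositive
    is the degree of D on this curve. *)
Lemma const_on_curve f i P Q x : let j := edge i 1 in
  f * D i = chart_fun r i P -> f * D j = chart_fun r j Q ->
  pairing (s i - s j) (fan_ray r (edge i 0)) <= 0 ->
  pairing (s i - s j) (fan_ray r (edge i 1)) = 0 ->
  P.@[pt2 x 0] = P.@[pt2 0 0].
Proof.
move=> j hP hQ n0 e0; pose n := pairing (s i - s j) (fan_ray r (edge i 0)).
pose p := mmap polyC (pt2 'X 0) P; pose q := mmap polyC (pt2 0 'X) Q.
have hp y : p.[y] = P.@[pt2 y 0].
  rewrite horner_mmap; apply: meval_ext => c; rewrite /pt2.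
  by case: eqP => _; rewrite ?hornerX ?horner0.
have hq y : q.[y] = Q.@[pt2 0 y].
  rewrite horner_mmap; apply: meval_ext => c; rewrite /pt2.
  by case: eqP => _; rewrite ?hornerX ?horner0.
rewrite -!hp; apply: (@poly_const_inv _ p q `|n|%N) => {}x x0.
(* The relation between P and Q is known where the second coordinate y is not
   zero; for fixed x both sides are polynomials in y, so it extends to y = 0. *)
pose pP := mmap polyC (pt2 x%:P 'X) P.
pose e := pairing (dual_basis r j 0) (fan_ray r (edge i 0)).
pose pQ := mmap polyC (pt2 ((x ^ e)%:P * 'X) (x^-1)%:P) Q.
suff /(congr1 (fun p => p.[0])) : x ^+ `|n| *: pP = pQ.
  rewrite hp hq hornerZ /pP /pQ !horner_mmap => h.
  have -> : P.@[pt2 x 0] = P.@[fun c => (pt2 x%:P 'X c).[0]].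
    apply: meval_ext => c; rewrite /pt2.
    by case: eqP => _; rewrite ?hornerX ?hornerC.
  rewrite h; apply: meval_ext => c; rewrite /pt2.
  by case: eqP => _; rewrite ?hornerM ?hornerX ?hornerC ?mulr0.
apply: poly_eq_neq0 => y y0; rewrite hornerZ /pP /pQ !horner_mmap.
have v0 c : pt2 x y c != 0 by rewrite /pt2; case: ifP.
have -> : P.@[fun c => (pt2 x%:P 'X c).[y]] = P.@[pt2 x y].
  apply: meval_ext => c; rewrite /pt2.
  by case: eqP => _; rewrite ?hornerX ?hornerC.
rewrite (section_transition v0 hP hQ) char_valueE /= e0 expr0z mulr1.
rewrite mulrCA -/n /pt2 eqxx.
have -> : x ^+ `|n| * x ^ n = 1.
  have -> : n = - `|n|%N%:Z by rewrite /n in n0 *; lia.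
  by rewrite abszN absz_nat -exprnN mulfV // expf_neq0.
rewrite mulr1; apply: meval_ext => c.
rewrite char_valueE /=.
case: (ord2P c) => -> /=; rewrite ?hornerM ?hornerX ?hornerC.
  by rewrite edge_next pairing_dual expr1z.
by rewrite dual_next !pairingN !pairing_dual /= exprN1 oppr0 expr0z mulr1.
Qed.

Lemma very_ample_degree_gt0 i : let j := edge i 1 in
  pairing (s i - s j) (fan_ray r (edge i 1)) = 0 ->
  very_ample D -> 0 < pairing (s i - s j) (fan_ray r (edge i 0)).
Proof.
move=> j e0 [N [t [P [hP [_ inj _ _]]]]]; rewrite ltNge; apply/negP => n0.
have /inj[_ _] : proportional (proj_image P (i, pt2 1 0))
    (proj_image P (i, pt2 0 0)).
  exists 1; rewrite ?oner_neq0 // => c; rewrite mul1r /proj_image /=.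
  exact: const_on_curve (hP i c) (hP j c) n0 e0.
move=> /(_ (dual_basis r i 0)); rewrite !char_value_dual /pt2 /=.
move=> h; have /h/eqP : forall rho, in_cone i rho -> in_cone i rho ->
    0 <= pairing (dual_basis r i 0) (fan_ray r rho).
  by move=> rho /existsP[c /eqP <-] _; rewrite pairing_dual.
by rewrite oner_eq0.
Qed.

End Transition.
End InvariantCurves.

(** * Change of chart *)

Section CharValue.
Variables (k : closedFieldType) (r : nat).
Implicit Types (p q : chart_point k) (m : lattice).

(** The monomial expressing the character m in the chart of p has no negative
    power of a coordinate that vanishes at p. *)
Definition char_defined p m : Prop :=
  forall c, p.2 c = 0 -> 0 <= pairing m (fan_ray r (edge p.1 c)).

Lemma char_definedD p m m' :
  char_defined p m -> char_defined p m' -> char_defined p (m + m').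
Proof. by move=> h h' c pc; rewrite pairingD addr_ge0 ?h ?h'. Qed.

Lemma char_definedMn p m n : char_defined p m -> char_defined p (m *+ n).
Proof. by move=> h c pc; rewrite pairingMn mulr_ge0 ?h. Qed.

Lemma char_valueD p m m' : char_defined p m -> char_defined p m' ->
  char_value r p (m + m') = char_value r p m * char_value r p m'.
Proof.
move=> h h'; rewrite /char_value -big_split; apply: eq_bigr => c _ /=.
rewrite pairingD; have [pc|pc] := eqVneq (p.2 c) 0; last exact: expfzDr.
by apply: exprzD_ss; rewrite h ?h'.
Qed.

Lemma char_value0 p : char_value r p 0 = 1.
Proof. by rewrite /char_value big1 // => c _; rewrite pairing0 expr0z. Qed.

Lemma char_valueMn p m n : char_defined p m ->
  char_value r p (m *+ n) = char_value r p m ^+ n.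
Proof.
move=> h; elim: n => [|n IHn]; first by rewrite char_value0.
by rewrite mulrS char_valueD ?IHn ?exprS //; apply: char_definedMn.
Qed.

(** The point p in the coordinates of the chart j; meaningful when p lies in
    this chart. *)
Definition change_chart p (j : 'I_4) : chart_point k :=
  (j, fun c => char_value r p (dual_basis r j c)).

Lemma in_overlap0 p j c : in_overlap p j -> p.2 c = 0 ->
  in_cone j (edge p.1 c).
Proof. by move=> h pc; apply: contraT => /h; rewrite pc eqxx. Qed.

(** This holds for all m, even where a negative power of 0 occurs: if p.2 c = 0
    then the ray of c is also in the cone j, hence this coordinate vanishes in
    both charts and has the same exponent in both expressions of m. *)
Lemma char_value_change p j m : in_overlap p j ->
  char_value r (change_chart p j) m = char_value r p m.
Proof.
move=> hp; rewrite char_valueE /= !char_valueE !expfzMl !exprz_exp mulrACA.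
suff h c : p.2 c ^ (pairing (dual_basis r j 0) (fan_ray r (edge p.1 c)) *
                      pairing m (fan_ray r (edge j 0))) *
           p.2 c ^ (pairing (dual_basis r j 1) (fan_ray r (edge p.1 c)) *
                      pairing m (fan_ray r (edge j 1))) =
           p.2 c ^ pairing m (fan_ray r (edge p.1 c)) by rewrite !h.
have [/(in_overlap0 hp)/existsP[d /eqP <-]|pc] := eqVneq (p.2 c) 0.
  rewrite !pairing_dual; case: (ord2P d) => -> /=;
  by rewrite ?mul0r ?mul1r ?expr0z ?mul1r ?mulr1.
by rewrite -expfzDr // [in RHS](pairing_dual_decomp r j m).
Qed.

Lemma same_point_change p j :
  in_overlap p j -> same_point r p (change_chart p j).
Proof.
move=> hp; split=> // [c hc|m _]; last by rewrite char_value_change.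
rewrite /= /char_value prodf_seq_neq0; apply/allP => d _ /=.
rewrite expfz_eq0 negb_and.
have [/(in_overlap0 hp)/existsP[c' /eqP e]|_] := eqVneq (p.2 d) 0;
  last by rewrite orbT.
rewrite -e pairing_dual; have [cc'|//] := eqVneq c c'.
by rewrite /= cc' e in_cone_edge in hc.
Qed.

End CharValue.

(** * Homogenization *)

Section Homogenize.
Variables (k : closedFieldType) (N : nat) (o : 'I_N.+1) (x : 'I_2 -> 'I_N.+1).

(** The form of degree n that becomes Q, in the variables x 0 and x 1, when the
    variable o is set to 1; the degree of Q must be at most n. *)
Definition homogenize n (Q : {mpoly k[2]}) : {mpoly k[N.+1]} :=
  \sum_(m <- msupp Q)
    Q@_m *: ('X_o ^+ (n - mdeg m) * \prod_(d < 2) 'X_(x d) ^+ m d).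

Lemma dhomog_homogenize n Q : (msize Q <= n.+1)%N ->
  homogenize n Q \is n.-homog.
Proof.
move=> hn; rewrite /homogenize big_seq; apply: rpred_sum => m hm.
apply: dhomogZ; have mn : (mdeg m <= n)%N.
  by rewrite -ltnS; apply: leq_trans (msize_mdeg_lt hm) hn.
rewrite big_ord2 /= !mpolyXn -!mpolyXD dhomogX /= !mdegD !mdegMn !mdeg1 !mul1n.
by rewrite mdegE big_ord2 /= in mn *; apply/eqP; lia.
Qed.

Lemma mmap_homogenize (F : fieldType) (f : {rmorphism k -> F})
    (h : 'I_N.+1 -> F) n Q : (msize Q <= n.+1)%N -> h o != 0 ->
  mmap f h (homogenize n Q) = h o ^+ n * mmap f (fun d => h (x d) / h o) Q.
Proof.
move=> hn ho; rewrite raddf_sum /= [in RHS]/mmap mulr_sumr.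
rewrite big_seq [RHS]big_seq; apply: eq_bigr => m hm.
have mn : (mdeg m <= n)%N.
  by rewrite -ltnS; apply: leq_trans (msize_mdeg_lt hm) hn.
rewrite mmapZ mulrCA; congr (_ * _).
rewrite rmorphM rmorphXn /= mmapX mmap1U !big_ord2 rmorphM !rmorphXn /=.
rewrite !mmapX !mmap1U /mmap1 big_ord2 !expr_div_n.
rewrite -[in RHS](subnK mn) exprD mdegE big_ord2 exprD /=.
have := expf_neq0 (m 0) ho; have := expf_neq0 (m 1) ho.
move: (h o ^+ m 0) (h o ^+ m 1) (h o ^+ _) (h _ ^+ _) (h _ ^+ _) => a b c u v.
by move=> b0 a0; field; rewrite a0 b0.
Qed.

End Homogenize.

(** * The embedding by vertex and edge sections *)

Lemma character_add (k : closedFieldType) (m m' : lattice) :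
  character k (m + m') = character k m * character k m'.
Proof. exact: characterD. Qed.

Lemma divf_translate (F : fieldType) (a b c : F) :
  c != 0 -> b = a * c -> b / c = a.
Proof. by move=> c0 ->; rewrite mulfK. Qed.

Lemma divf_scale (F : fieldType) (a b c : F) :
  c != 0 -> (c * a) / (c * b) = a / b.
Proof. by move=> c0; rewrite invfM mulrACA divff // mul1r. Qed.

Section Embedding.
Variables (k : closedFieldType) (r : nat).
(* s i is the character that defines the divisor on the chart i, so - s i is the
   vertex of the polygon that corresponds to the cone i.  The hypothesis s_pos
   says that the degree on each of the four invariant curves is positive. *)
Variables (s : 'I_4 -> lattice).
Hypothesis s_glue : forall i j rho, in_cone i rho -> in_cone j rho ->
  pairing (s i) (fan_ray r rho) = pairing (s j) (fan_ray r rho).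
Hypothesis s_pos : forall i,
  0 < pairing (s i - s (edge i 1)) (fan_ray r (edge i 0)).

(** Consecutive vertices are joined by an edge of the polygon, directed by a
    vector of the dual basis, of lattice length l. *)
Lemma s_step i : exists2 l, (0 < l)%N &
  s i - s (edge i 1) = dual_basis r i 0 *+ l.
Proof.
have h := s_pos i.
exists (absz (pairing (s i - s (edge i 1)) (fan_ray r (edge i 0)))).
  by rewrite absz_gt0 gt_eqF.
apply: (@lattice_ext r i) => c; rewrite pairingMn pairing_dual.
case: (ord2P c) => ->; first by rewrite eqxx mulr1 gez0_abs // ltW.
rewrite mulr0 pairingB (@s_glue i (edge i 1)) ?subrr ?in_cone_edge //.
by rewrite [X in in_cone _ X]edge_next in_cone_edge.
Qed.

Lemma s_edge i c : exists j, exists2 l, (0 < l)%N &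
  s i - s j = dual_basis r i c *+ l.
Proof.
case: (ord2P c) => ->; first by exists (edge i 1); apply: s_step.
have [j ->] := edge_pred i; exists j; have [l l0 h] := s_step j.
by exists l => //; rewrite -opprB h dual_next mulNrn.
Qed.

(** Strict convexity: at the vertex j, the inequalities of the polygon given by
    the rays outside the cone j are strict. *)
Lemma s_convex i j c : ~~ in_cone j (edge i c) ->
  0 < pairing (s i - s j) (fan_ray r (edge i c)).
Proof.
have [j' ej] := edge_pred j; move: (in_cone_edge i c).
case: (ray_cases j' (edge i c)); rewrite -?ej => -> hi.
- move=> _; rewrite pairingB (@s_glue i j') ?in_cone_edge // -pairingB ej.
  exact: s_pos.
- by rewrite in_cone_edge.
- by rewrite in_cone_edge.
move=> _; rewrite pairingB (@s_glue i (edge j 1)) ?in_cone_edge // -pairingB.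
have [l l0 h] := s_step j.
by rewrite -opprB h -mulNrn -dual_next pairingMn pairing_dual mulr1.
Qed.

Lemma s_convexW i j c : 0 <= pairing (s i - s j) (fan_ray r (edge i c)).
Proof.
have [h|/s_convex/ltW//] := boolP (in_cone j (edge i c)).
by rewrite pairingB (@s_glue i j) ?subrr ?in_cone_edge.
Qed.

(* The lattice points of the sections: the vertices, and the next lattice point
   along each edge that starts at a vertex. *)
Variables (N : nat) (mu : 'I_N.+1 -> lattice) (vtx : 'I_4 -> 'I_N.+1).
Variable nb : 'I_4 -> 'I_2 -> 'I_N.+1.
Hypothesis mu_vtx : forall i, mu (vtx i) = - s i.
Hypothesis mu_nb : forall i d, mu (nb i d) = dual_basis r i d - s i.
Hypothesis mu_cases : forall c,
  (exists i, c = vtx i) \/ (exists i d, c = nb i d).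

(** The points mu c lie in the polygon. *)
Lemma mu_ge0 i c d : 0 <= pairing (mu c + s i) (fan_ray r (edge i d)).
Proof.
case: (mu_cases c) => [[j ->]|[j [e ->]]].
  by rewrite mu_vtx addrC s_convexW.
rewrite mu_nb -addrA [- s j + _]addrC pairingD.
have [/existsP[f /eqP ef]|hj] := boolP (in_cone j (edge i d)).
  by rewrite -{1}ef pairing_dual addr_ge0 // s_convexW.
(* The point is on the edge from the vertex j to the vertex j', and both satisfy
   the inequality. *)
have [j' [l l0 /(congr1 (pairing^~ (fan_ray r (edge i d))))]] := s_edge j e.
rewrite pairingMn => h.
have := s_convex hj; have := s_convexW i j' d.
move: h; rewrite !pairingB; move: (pairing _ _) (pairing _ _) (pairing _ _).
move: (pairing _ _) => x y z t; nia.
Qed.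

Implicit Types (p q : chart_point k).

(** The homogeneous coordinates of the image of p, normalized so that the vertex
    section of the chart of p is 1. *)
Definition phi p (c : 'I_N.+1) : k := char_value r p (mu c + s p.1).

Lemma mu_defined p c : char_defined r p (mu c + s p.1).
Proof. by move=> d _; apply: mu_ge0. Qed.

Lemma phi_vtx p : phi p (vtx p.1) = 1.
Proof. by rewrite /phi mu_vtx addNr char_value0. Qed.

Lemma phi_nb p d : phi p (nb p.1 d) = p.2 d.
Proof. by rewrite /phi mu_nb subrK char_value_dual. Qed.

Lemma phi_vtx_overlap p j : phi p (vtx j) != 0 -> in_overlap p j.
Proof.
move=> h c hc; apply: contra h => /eqP pc.
rewrite /phi mu_vtx addrC /char_value (bigD1 c) //= pc.
by rewrite exp0rz gt_eqF ?mul0r // s_convex.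
Qed.

Lemma phi_same p q c : same_point r p q -> phi p c = phi p (vtx q.1) * phi q c.
Proof.
case=> hp _ /(_ (mu c + s q.1)) h; rewrite /phi -h; last first.
  by move=> rho _ /existsP[d /eqP <-]; apply: mu_ge0.
rewrite -char_valueD ?mu_vtx; last first.
- by move=> d /(in_overlap0 hp)/existsP[d' /eqP <-]; apply: mu_ge0.
- by rewrite -mu_vtx; apply: mu_defined.
by congr char_value; rewrite [RHS]addrC addrA addrK.
Qed.

(** Where the vertex section j does not vanish, the coordinates of the chart j
    are the quotients by it of the sections next to it. *)
Lemma phi_change p j : phi p (vtx j) != 0 ->
  [/\ same_point r p (change_chart r p j),
      forall c, phi p c = phi p (vtx j) * phi (change_chart r p j) c
    & forall d, (change_chart r p j).2 d = phi p (nb j d) / phi p (vtx j)].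
Proof.
move=> h0; have h := same_point_change r (phi_vtx_overlap h0).
split=> // [c|d]; first exact: phi_same h.
have := phi_same (nb j d) h; rewrite (phi_nb (change_chart r p j)) /= => ->.
by rewrite mulrC mulKf.
Qed.

Lemma character_coord i m :
  character k m =
  \prod_(d < 2) Defs.coord k r i d ^ pairing m (fan_ray r (edge i d)).
Proof.
rewrite big_ord2 /= /Defs.coord !characterXz -characterD /=.
by rewrite {1}(lattice_dual r i m).
Qed.

(** The monomial that expresses the section c in the chart i. *)
Definition section_poly i c : {mpoly k[2]} :=
  'X_[[multinom absz (pairing (mu c + s i)%R (fan_ray r (edge i d))) | d < 2]].

Lemma chart_fun_section i c :
  chart_fun r i (section_poly i c) = character k (mu c + s i).
Proof.
rewrite /chart_fun mmapX /mmap1 (character_coord i) !big_ord2 /= !mnmE.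
by rewrite !exprnP !gez0_abs ?mu_ge0.
Qed.

Lemma proj_image_section p : proj_image section_poly p =1 phi p.
Proof.
move=> c; rewrite /proj_image mevalX /phi char_valueE big_ord2 /= !mnmE.
by rewrite !exprnP !gez0_abs ?mu_ge0.
Qed.

Lemma meval_homogenize i n (Q : {mpoly k[2]}) y : (msize Q <= n.+1)%N ->
  y (vtx i) != 0 ->
  (homogenize (vtx i) (nb i) n Q).@[y] =
  y (vtx i) ^+ n * Q.@[fun d => y (nb i d) / y (vtx i)].
Proof. exact: (@mmap_homogenize k N (vtx i) (nb i) k idfun). Qed.

Lemma meval_scale (G : {mpoly k[N.+1]}) n (y z : 'I_N.+1 -> k) a :
  G \is n.-homog -> (forall c, y c = a * z c) -> G.@[y] = a ^+ n * G.@[z].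
Proof.
move=> /dhomogP hG yz; rewrite !mevalE mulr_sumr big_seq [RHS]big_seq.
apply: eq_bigr => m /hG hm; rewrite mulrCA; congr (_ * _).
under eq_bigr do rewrite yz exprMn.
by rewrite big_split /= prodrXr -hm /= mdegE.
Qed.

(** The neighbour of a vertex along an edge of lattice length l is a convex
    combination of both ends of the edge, with weights (l - 1)/l and 1/l. *)
Lemma phi_edge i d : exists j, exists2 l, (0 < l)%N &
  forall p, phi p (nb i d) ^+ l = phi p (vtx i) ^+ l.-1 * phi p (vtx j).
Proof.
have [j [l l0 h]] := s_edge i d; exists j, l => // p; rewrite /phi.
rewrite -!char_valueMn -?char_valueD; try exact: mu_defined.
- congr char_value; rewrite !mu_vtx mu_nb; apply: (@lattice_ext r i) => c.
  have := congr1 (pairing^~ (fan_ray r (edge i c))) h.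
  case: (l) l0 => // l' _ /=.
  rewrite !(pairingD, pairingMn, pairingN).
  move: (pairing (dual_basis _ _ _) _) (pairing (s i) _) (pairing (s j) _).
  by move: (pairing _ _) => x y z t; lia.
- by apply: char_definedMn; apply: mu_defined.
Qed.

(** Each section is, relative to the vertex section i, a monomial in the two
    neighbours of this vertex. *)
Lemma phi_binomial i c : exists e : 'I_2 -> nat,
  (forall d, pairing (mu c + s i) (fan_ray r (edge i d)) = e d) /\
  forall p, phi p c * phi p (vtx i) ^+ (e 0 + e 1) =
    phi p (vtx i) * (phi p (nb i 0) ^+ e 0 * phi p (nb i 1) ^+ e 1).
Proof.
pose e d := absz (pairing (mu c + s i) (fan_ray r (edge i d))).
have he d : pairing (mu c + s i) (fan_ray r (edge i d)) = e d.
  by rewrite gez0_abs // mu_ge0.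
exists e; split=> // p; rewrite /phi.
rewrite -!char_valueMn; try exact: mu_defined.
have hn c' n := char_definedMn n (@mu_defined p c').
rewrite -!char_valueD; try exact: char_definedD; try exact: mu_defined;
  try exact: hn.
congr char_value; rewrite !mu_vtx !mu_nb; apply: (@lattice_ext r i) => d.
rewrite !(pairingD, pairingMn, pairingN) !pairing_dual.
have := he d; rewrite pairingD.
by case: (ord2P d) => -> h /=; lia.
Qed.

Lemma proportional_phi p q :
  (exists2 a : k, a != 0 & forall c, phi p c = a * phi q c) -> same_point r p q.
Proof.
case=> a a0 h; have hj : phi p (vtx q.1) = a by rewrite h phi_vtx mulr1.
have [] := @phi_change p q.1; first by rewrite hj.
move=> + _ hw; congr same_point; case: q h hj hw => j w /= h hj hw.
congr (_, _); apply: functional_extensionality => d.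
by rewrite hw hj h (phi_nb (j, w)) mulrC mulKf.
Qed.

(** A zero of all forms vanishing on the image of X, with a nonzero vertex
    coordinate, is the image of a point of the corresponding chart. *)
Lemma phi_recover i y :
  (forall G d, G \is d.-homog -> (forall p, G.@[phi p] = 0) -> G.@[y] = 0) ->
  y (vtx i) != 0 ->
  forall c, y c = y (vtx i) * phi (i, fun d => y (nb i d) / y (vtx i)) c.
Proof.
move=> hy y0 c; have [e [he hphi]] := phi_binomial i c.
pose G : {mpoly k[N.+1]} := 'X_c * 'X_(vtx i) ^+ (e 0 + e 1) -
  'X_(vtx i) * ('X_(nb i 0) ^+ e 0 * 'X_(nb i 1) ^+ e 1).
have evG z : G.@[z] = z c * z (vtx i) ^+ (e 0 + e 1) -
    z (vtx i) * (z (nb i 0) ^+ e 0 * z (nb i 1) ^+ e 1).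
  by rewrite /G mevalB !mevalM !rmorphXn /= !mevalXU.
have hG : G \is (e 0 + e 1).+1.-homog.
  rewrite /G !mpolyXn -!mpolyXD rpredB // dhomogX /=;
  by rewrite !mdegD !mdegMn !mdeg1 !mul1n.
have : G.@[y] = 0 by apply: hy hG _ => p; rewrite evG hphi subrr.
rewrite evG => /subr0_eq.
rewrite /phi char_valueE /= !he -!exprnP !expr_div_n exprD.
have := expf_neq0 (e 0) y0; have := expf_neq0 (e 1) y0.
move: (y (vtx i) ^+ e 0) (y (vtx i) ^+ e 1) => a b b0 a0 h.
have ab0 : a * b != 0 by rewrite mulf_neq0.
by apply: (mulIf ab0); rewrite h; field; rewrite a0 b0.
Qed.

Lemma exists_vtx_neq0 y :
  (forall G d, G \is d.-homog -> (forall p, G.@[phi p] = 0) -> G.@[y] = 0) ->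
  (exists c, y c != 0) -> exists i, y (vtx i) != 0.
Proof.
move=> hy [c yc]; case: (mu_cases c) yc => [[i ->]|[i [d ->]]] yc.
  by exists i.
have [j [l l0 hphi]] := phi_edge i d; exists j; apply: contra yc => /eqP yj.
pose G : {mpoly k[N.+1]} := 'X_(nb i d) ^+ l - 'X_(vtx i) ^+ l.-1 * 'X_(vtx j).
have evG z : G.@[z] = z (nb i d) ^+ l - z (vtx i) ^+ l.-1 * z (vtx j).
  by rewrite /G mevalB !mevalM !rmorphXn /= !mevalXU.
have hG : G \is l.-homog.
  rewrite /G !mpolyXn -!mpolyXD rpredB // dhomogX /=.
    by rewrite mdegMn mdeg1 mul1n.
  by rewrite mdegD mdegMn !mdeg1 mul1n addn1 prednK.
have : G.@[y] = 0 by apply: hy hG _ => p; rewrite evG hphi subrr.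
by rewrite evG yj mulr0 subr0 => /eqP; rewrite expf_eq0 l0.
Qed.

Lemma phi_closed (Z : chart_point k -> Prop) : zariski_closed r Z ->
  proj_closed (fun y =>
    exists2 p, Z p & proportional y (proj_image section_poly p)).
Proof.
move=> [Zsat Zeq].
pose I (G : {mpoly k[N.+1]}) := (exists d : nat, G \is d.-homog) /\
  forall p, Z p -> G.@[phi p] = 0.
exists I; split=> [G []//|y y0]; split.
  move=> [p Zp [a a0 hy]] G [[d hG] hI].
  rewrite (meval_scale (z := phi p) (a := a) hG) ?hI ?mulr0 // => c.
  by rewrite hy proj_image_section.
move=> hy; have hy' G d : G \is d.-homog -> (forall p, G.@[phi p] = 0) ->
    G.@[y] = 0.
  by move=> hG h; apply: hy; split=> [|p _]; [exists d | apply: h].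
have [i yi] := exists_vtx_neq0 hy' y0.
pose v d := y (nb i d) / y (vtx i).
exists (i, v); last first.
  by exists (y (vtx i)) => // c; rewrite proj_image_section; apply: phi_recover.
have [J hJ] := Zeq i; apply/hJ => Q JQ.
pose n := msize Q; have hn : (msize Q <= n.+1)%N by rewrite ltnW.
(* The factor 'X_(vtx i) makes G vanish at the images of the points of Z outside
   the chart i. *)
pose G := 'X_(vtx i) * homogenize (vtx i) (nb i) n Q.
have : G.@[y] = 0.
  apply: hy; split.
    exists (1 + n)%N; apply: dhomogM; last exact: dhomog_homogenize.
    by rewrite dhomogX /= mdeg1.
  move=> p Zp; rewrite mevalM mevalXU.
  have [->|pi0] := eqVneq (phi p (vtx i)) 0; first by rewrite mul0r.
  have [hp _ hw] := phi_change pi0.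
  rewrite meval_homogenize // (_ : Q.@[_] = 0) ?mulr0 //.
  rewrite -(meval_ext _ hw); apply: (iffLR (hJ _)) => //.
  exact: Zsat hp Zp.
rewrite mevalM mevalXU meval_homogenize // => /eqP.
by rewrite !mulf_eq0 expf_eq0 (negPf yi) andbF /= => /eqP.
Qed.

Variables (D : cartier k r) (g : funfield k).
Hypothesis g_neq0 : g != 0.
Hypothesis Ds : forall i, D i = g * character k (s i).

(** The section c as a rational function. *)
Definition section_fun c : funfield k := g^-1 * character k (mu c).

Lemma section_funD i c : section_fun c * D i = chart_fun r i (section_poly i c).
Proof.
rewrite Ds chart_fun_section /section_fun mulrACA mulVf // mul1r -characterD.
by [].
Qed.

Lemma section_fun_neq0 c : section_fun c != 0.
Proof. by apply: mulf_neq0; [rewrite invr_eq0 | apply: character_neq0]. Qed.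

Lemma section_fun_nb i d :
  section_fun (nb i d) / section_fun (vtx i) = Defs.coord k r i d.
Proof.
apply: divf_translate (section_fun_neq0 _) _.
rewrite /section_fun mu_nb mu_vtx (character_add _ (dual_basis _ _ _)).
exact: mulrCA.
Qed.

Lemma chart_fun_homogenize i n (Q : {mpoly k[2]}) : (msize Q <= n.+1)%N ->
  mmap (@ffconst k) section_fun (homogenize (vtx i) (nb i) n Q) =
  section_fun (vtx i) ^+ n * chart_fun r i Q.
Proof.
move=> hn; rewrite (mmap_homogenize _ _ hn (section_fun_neq0 _)).
rewrite /chart_fun; congr (_ * mmap _ _ _).
by apply: functional_extensionality => d; apply: section_fun_nb.
Qed.

Lemma phi_local p f : regular_at r p f ->
  exists (d : nat) (G H : {mpoly k[N.+1]}),
    [/\ G \is d.-homog, H \is d.-homog, H.@[proj_image section_poly p] != 0 &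
       f = mmap (@ffconst k) section_fun G / mmap (@ffconst k) section_fun H].
Proof.
move=> [P [Q [Q0 ->]]]; pose n := maxn (msize P) (msize Q).
have hP : (msize P <= n.+1)%N by rewrite ltnW // ltnS leq_maxl.
have hQ : (msize Q <= n.+1)%N by rewrite ltnW // ltnS leq_maxr.
exists n, (homogenize (vtx p.1) (nb p.1) n P).
exists (homogenize (vtx p.1) (nb p.1) n Q).
split; [exact: dhomog_homogenize | exact: dhomog_homogenize | |].
  rewrite (meval_ext _ (proj_image_section p)) meval_homogenize // phi_vtx;
    last exact: oner_neq0.
  rewrite expr1n mul1r (_ : Q.@[_] = Q.@[p.2]) //.
  by apply: meval_ext => d; rewrite phi_nb divr1.
rewrite !chart_fun_homogenize //; apply: esym; apply: divf_scale.
exact/expf_neq0/section_fun_neq0.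
Qed.

Lemma very_ample_sections : very_ample D.
Proof.
exists N, section_fun, section_poly; split=> [i c|]; first exact: section_funD.
split=> [p|p q [a a0 h]||].
- exists (vtx p.1); rewrite proj_image_section phi_vtx; exact: oner_neq0.
- apply: proportional_phi; exists a => // c.
  by have := h c; rewrite !proj_image_section.
- exact: phi_closed.
- exact: phi_local.
Qed.

End Embedding.

(** * The ampleness criterion *)

Lemma edge_val0 i : edge i 0 = i :> nat.
Proof. by case: i => -[|[|[|[|//]]]] hi. Qed.

Lemma edge_val1 i : edge i 1 = nth 0%N [:: 1; 2; 3; 0]%N i :> nat.
Proof. by case: i => -[|[|[|[|//]]]] hi. Qed.

Section Criterion.
Variables (k : closedFieldType) (r : nat).
Implicit Types (D E : cartier k r) (a b : nat -> int).

Lemma very_ample_of_degrees D (g : funfield k) (s : 'I_4 -> lattice) :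
  (forall i, D i = g * character k (s i)) -> g != 0 ->
  (forall i j rho, in_cone i rho -> in_cone j rho ->
    pairing (s i) (fan_ray r rho) = pairing (s j) (fan_ray r rho)) ->
  (forall i, 0 < pairing (s i - s (edge i 1)) (fan_ray r (edge i 0))) ->
  very_ample D.
Proof.
move=> Ds g0 s_glue s_pos.
(* The 12 sections are indexed by the pairs of a vertex i and e < 3: e = 0 for
   the vertex itself, e = d + 1 for its neighbour in the direction d. *)
pose M : 'M[lattice]_(4, 3) := \matrix_(i, e)
  (if unlift ord0 e is Some d then dual_basis r i d - s i else - s i).
have mu_vtx i : mxvec M 0 (mxvec_index i ord0) = - s i.
  by rewrite mxvecE mxE unlift_none.
have mu_nb i d :
    mxvec M 0 (mxvec_index i (lift ord0 d)) = dual_basis r i d - s i.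
  by rewrite mxvecE mxE liftK.
apply: (@very_ample_sections k r s s_glue s_pos 11 _ _ _ mu_vtx mu_nb _ D g)
  => //.
move=> c; have [i e] := @mxvec_indexP 4 3 c.
by case: (unliftP ord0 e) => [d|] ->; [right; exists i, d | left; exists i].
Qed.

(** D is the sum of the a n D_n, n < 4, plus the divisor of a rational function
    g: on the chart i it is defined by g times a character s i whose value on
    each ray n of the cone i is a n.  The coefficients are indexed by nat; only
    the first four matter. *)
Definition toric_coeffs D a : Prop :=
  exists (g : funfield k) (s : 'I_4 -> lattice),
    [/\ g != 0, forall i, D i = g * character k (s i)
      & forall i c, pairing (s i) (fan_ray r (edge i c)) = a (edge i c)].

Lemma toric_coeffs_ext D a b : a =1 b -> toric_coeffs D a -> toric_coeffs D b.
Proof.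
move=> ab [g [s [g0 Ds hs]]]; exists g, s; split=> // i c.
by rewrite hs ab.
Qed.

Lemma toric_coeffsD D E a b : toric_coeffs D a -> toric_coeffs E b ->
  toric_coeffs (cartier_add D E) (fun n => a n + b n).
Proof.
move=> [g [s [g0 Ds hs]]] [h [t [h0 Et ht]]].
exists (g * h), (fun i => s i + t i); split; first exact: (mulf_neq0 g0 h0).
  by move=> i; rewrite /= Ds Et character_add mulrACA.
by move=> i c; rewrite pairingD hs ht.
Qed.

Lemma toric_coeffsN D a : toric_coeffs D a ->
  toric_coeffs (cartier_opp D) (fun n => - a n).
Proof.
move=> [g [s [g0 Ds hs]]].
exists g^-1, (fun i => - s i); split; first by rewrite invr_eq0.
  by move=> i; rewrite /= Ds invfM characterV.
by move=> i c; rewrite pairingN hs.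
Qed.

Lemma toric_coeffsMn D a m : toric_coeffs D a ->
  toric_coeffs (cartier_mul D m) (fun n => m%:Z * a n).
Proof.
move=> hD; elim: m => [|m IHm].
  exists 1, (fun=> 0); split=> [|i|i c]; first exact: oner_neq0.
    by rewrite /= mul1r /character /= !expr0z mul1r.
  by rewrite pairing0 mul0r.
by apply: toric_coeffs_ext (toric_coeffsD hD IHm) => n; lia.
Qed.

Lemma toric_coeffs_torus_div j : (j < 4)%N ->
  toric_coeffs (torus_div k r (inord j)) (fun n => (n == j)%:Z).
Proof.
move=> j4; exists 1; eexists; split; first exact: oner_neq0.
  by move=> i; rewrite mul1r; apply: torus_div_eqE.
move=> i c; rewrite pairing_weight ?in_cone_edge //.
by rewrite -val_eqE /= inordK.
Qed.

(** The form dx /\ dy is the invariant form of the torus times the character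
    (1, 1), so the coefficient of D_n in its divisor is the value of (1, 1) on
    the ray n, minus 1. *)
Lemma toric_coeffs_canonical (K : cartier k r) : canonical_divisor K ->
  toric_coeffs K (nth 0 [:: - 2; 0; 0; r%:Z - 2]).
Proof.
case=> w [w0 ->]; exists w; eexists; split; first exact: w0.
  by move=> i; rewrite [LHS](form_div_eqE r w0) characterV.
move=> i c; rewrite [LHS](pairingN (_, _)) pairing_form_weight ?in_cone_edge //.
by move: (edge i c) => {i c} -[[|[|[|[|//]]]] hi];
  rewrite /pairing /fan_ray /=; lia.
Qed.

(** The degrees on D_1, D_2, D_3, D_0. *)
Lemma toric_degrees (s : 'I_4 -> lattice) a :
  (forall i c, pairing (s i) (fan_ray r (edge i c)) = a (edge i c)) ->
  forall i, pairing (s i - s (edge i 1)) (fan_ray r (edge i 0)) =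
    nth 0 [:: a 0%N + a 2%N; a 1%N + a 3%N - r%:Z * a 2%N;
              a 0%N + a 2%N; a 1%N + a 3%N + r%:Z * a 0%N] i.
Proof.
move=> hs i; rewrite pairingB hs.
rewrite (pairing_dual_decomp r (edge i 1)) !hs !edge_val0 !edge_val1.
by case: i => -[|[|[|[|//]]]] hi; rewrite /pairing /dual_basis /fan_ray /=; lia.
Qed.

Lemma ample_toric D a : toric_coeffs D a ->
  ample D <-> (0 < a 0%N + a 2%N) && (0 < a 1%N + a 3%N - r%:Z * a 2%N).
Proof.
move=> hD; split=> [[m m0]|/andP[h0 h1]].
  have [g [s [g0 Ds hs]]] := toric_coeffsMn m hD.
  have he i : pairing (s i - s (edge i 1)) (fan_ray r (edge i 1)) = 0.
    have := hs (edge i 1) 0; rewrite -edge_next => h.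
    by rewrite pairingB hs h subrr.
  move=> va; have := very_ample_degree_gt0 Ds (he 0) va.
  have := very_ample_degree_gt0 Ds (he 1) va.
  rewrite !(toric_degrees (a := fun n => m%:Z * a n) hs) /= => h1 h0.
  rewrite -(@pmulr_rgt0 _ m%:Z) ?mulrDr ?h0 //=.
  by rewrite -(@pmulr_rgt0 _ m%:Z) //; lia.
exists 1%N => //; have [g [s [g0 Ds hs]]] := toric_coeffsMn 1 hD.
apply: (very_ample_of_degrees Ds g0) => [i j rho|i].
  by move=> /existsP[c /eqP <-] /existsP[d /eqP cd]; rewrite hs -cd hs cd.
have h2 : 0 <= r%:Z * (a 0%N + a 2%N) by apply: mulr_ge0 (ltW h0).
rewrite (toric_degrees (a := fun n => 1 * a n) hs).
by case: i => -[|[|[|[|//]]]] hi /=; lia.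
Qed.

End Criterion.

Local Open Scope complex_scope.
Local Open Scope cartier_scope.

Theorem theorem1p3 (R : realType) (r : nat) (K : cartier R[i] r)
    (hK : canonical_divisor K) :
  let D0 := torus_div R[i] r (inord 0) in
  let D1 := torus_div R[i] r (inord 1) in
  let D2 := torus_div R[i] r (inord 2) in
  let D3 := torus_div R[i] r (inord 3) in
  [/\ (ample (- K) <-> r = 0%N \/ r = 1%N) /\
      (ample (- (K + D0)) <-> r = 0%N \/ r = 1%N),
      (forall D : cartier R[i] r,
         [\/ D = D1, D = D3, D = D0 + D1 | D = D0 + D3] ->
         (ample (- (K + D)) <-> r = 0%N)),
      (forall D : cartier R[i] r,
         [\/ D = D2, D = D2 + D1 | D = D2 + D3] ->
         ample (- (K + D)))
    & (forall D : cartier R[i] r,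
         D = D0 + D2 \/ D = D1 + D3 ->
         ~ ample (- (K + D)))].
Proof.
move=> D0 D1 D2 D3.
have TK := toric_coeffs_canonical hK.
have T0 : toric_coeffs D0 _ := @toric_coeffs_torus_div R[i] r 0 isT.
have T1 : toric_coeffs D1 _ := @toric_coeffs_torus_div R[i] r 1 isT.
have T2 : toric_coeffs D2 _ := @toric_coeffs_torus_div R[i] r 2 isT.
have T3 : toric_coeffs D3 _ := @toric_coeffs_torus_div R[i] r 3 isT.
(* The two integers are the degrees of -(K + D) on D1 and D2. *)
have amp D b : toric_coeffs D b -> ample (- (K + D)) <->
    ((2 - b 0%N - b 2%N > 0) &&
     (2 - r%:Z - b 1%N - b 3%N + r%:Z * b 2%N > 0))%R.
  move=> TD; rewrite (ample_toric (toric_coeffsN (toric_coeffsD TK TD))) /=.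
  by lia.
have T02 := amp _ _ (toric_coeffsD T0 T2).
have T13 := amp _ _ (toric_coeffsD T1 T3).
have T01 := amp _ _ (toric_coeffsD T0 T1).
have T03 := amp _ _ (toric_coeffsD T0 T3).
have T21 := amp _ _ (toric_coeffsD T2 T1).
have T23 := amp _ _ (toric_coeffsD T2 T3).
split.
- split; last by rewrite (amp _ _ T0) /=; lia.
  by rewrite (ample_toric (toric_coeffsN TK)) /=; lia.
- by move=> D [] ->; rewrite ?(amp _ _ T1) ?(amp _ _ T3) ?T01 ?T03 /=; lia.
- by move=> D [] ->; rewrite ?(amp _ _ T2) ?T21 ?T23 /=; lia.
- by move=> D [] ->; rewrite ?T02 ?T13 /=; lia.
Qed.
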